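(* Let $N$ be the place-transition net with places $p_1,\dots,p_8$ and transitions $t_1,\dots,t_6$, whose arcs (all of multiplicity $1$ unless stated otherwise) are: $t_1$: input $p_1$; output $p_5$ with multiplicity $2$. $t_2$: inputs $p_4, p_5$; output $p_6$. $t_3$: inputs $p_4, p_5, p_8$; outputs $p_7, p_8$. $t_4$: input $p_6$ with multiplicity $2$; outputs $p_2$ and $p_4$ with multiplicity $2$. $t_5$: inputs $p_5, p_6$; outputs $p_3, p_4$. $t_6$: inputs $p_5, p_7$; outputs $p_3, p_4$. Let $x \geq 1$ be an integer and consider the initial marking $\{p_1, x\cdot p_4, p_8\}$ (one token in $p_1$, $x$ tokens in $p_4$, one token in $p_8$, no other tokens). Run $N$ as a strong Sleptsov net. Then every run of the net from this initial marking terminates (reaches a marking in which no transition is firable), and the terminal marking is $\{p_2, x\cdot p_4, p_8\}$ if $x>1$, and $\{p_3, x\cdot p_4, p_8\}$ if $x=1$. Thus, if a register with nonnegative integer value $v$ is stored in place $p_4$ as the marking $x=v+1$, the net, started by a token in $p_1$, puts a token into $p_3$ exactly when $v=0$ and into $p_2$ exactly when $v>0$, leaving the register unchanged.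
   Context: A place-transition net is $N=(P,T,A,\mu_0)$ with finite place set $P$, finite transition set $T$, arc multiplicities $A: P\times T \cup T\times P \to \mathbb{Z}_{\geq 0}$ (writing $a(p,t)$, $a(t,p)$), and markings $\mu: P\to\mathbb{Z}_{\geq 0}$, $\mu_0$ initial. The firability multiplicity of transition $t$ in marking $\mu$ is $c(t)=\min_{p: a(p,t)>0} \lfloor \mu(p)/a(p,t)\rfloor$; $t$ is firable if $c(t)>0$. In a strong Sleptsov net, at each step one firable transition $t$ whose $c(t)$ is maximal among all transitions is chosen (nondeterministically if several have the same maximal value) and fires $c(t)$ times at once: $\mu'(p)=\mu(p)-c(t)\,a(p,t)+c(t)\,a(t,p)$ for all $p\in P$. The net of the claim is the paper's zero-check net given in a figure; its arcs are as reconstructed from the firing sequences described in the paper's proof. *)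

(* Defs.v *)
From HB Require Import structures.
From mathcomp Require Import all_boot.

Set Implicit Arguments.
Unset Strict Implicit.
Unset Printing Implicit Defensive.

Record ptnet (P T : finType) : Type := PTNet {
  pre : P -> T -> nat;
  post : T -> P -> nat;
  init : {ffun P -> nat}
}.

Section StrongSleptsov.

Variables (P T : finType) (N : ptnet P T).
Implicit Types (mu : {ffun P -> nat}) (t : T).

(* The minimum of mu(p) %/ a(p,t) over the input places p of t. The seed of   *)
(* the iterated minn is itself one of the values, so it does not affect the   *)
(* result. The minimum is undefined when t has no input place; such a t gets  *)
(* the junk value 0.                                                          *)
Definition fire_mult mu t : nat :=
  if [pick p | 0 < pre N p t] is Some p0 then
    \big[minn/mu p0 %/ pre N p0 t]_(p | 0 < pre N p t) (mu p %/ pre N p t)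
  else 0.

Definition firable mu t : bool := 0 < fire_mult mu t.

(* The truncated subtraction is exact: fire_mult mu t * pre N p t <= mu p.    *)
Definition fire mu t : {ffun P -> nat} :=
  [ffun p => mu p - fire_mult mu t * pre N p t + fire_mult mu t * post N t p].

Definition sstep : rel {ffun P -> nat} := fun mu mu' =>
  [exists t, [&& firable mu t,
                 [forall u, fire_mult mu u <= fire_mult mu t]
               & mu' == fire mu t]].

Definition terminal mu : bool := [forall t, ~~ firable mu t].

(* A finite run is given by the markings that follow the initial one. *)
Definition finite_run (s : seq {ffun P -> nat}) : bool := path sstep (init N) s.

Definition final_marking (s : seq {ffun P -> nat}) : {ffun P -> nat} :=
  last (init N) s.

Definition maximal_run (s : seq {ffun P -> nat}) : Prop :=
  finite_run s /\ forall mu, ~~ sstep (final_marking s) mu.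

Definition infinite_run (r : nat -> {ffun P -> nat}) : Prop :=
  r 0 = init N /\ forall n, sstep (r n) (r n.+1).

(* There is no infinite run, and every run that cannot be continued has       *)
(* reached a marking in which no transition is firable.                       *)
Definition every_run_terminates : Prop :=
  (~ exists r, infinite_run r) /\
  (forall s, maximal_run s -> terminal (final_marking s)).

End StrongSleptsov.

Inductive place := p1 | p2 | p3 | p4 | p5 | p6 | p7 | p8.

Definition place_ord (p : place) : 'I_8 :=
  match p with
  | p1 => @Ordinal 8 0 isT | p2 => @Ordinal 8 1 isT
  | p3 => @Ordinal 8 2 isT | p4 => @Ordinal 8 3 isT
  | p5 => @Ordinal 8 4 isT | p6 => @Ordinal 8 5 isT
  | p7 => @Ordinal 8 6 isT | p8 => @Ordinal 8 7 isT
  end.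

Definition ord_place (i : 'I_8) : place :=
  nth p1 [:: p1; p2; p3; p4; p5; p6; p7; p8] i.

Lemma place_ordK : cancel place_ord ord_place. Proof. by case. Qed.

HB.instance Definition _ := Finite.copy place (can_type place_ordK).

Inductive trans := t1 | t2 | t3 | t4 | t5 | t6.

Definition trans_ord (t : trans) : 'I_6 :=
  match t with
  | t1 => @Ordinal 6 0 isT | t2 => @Ordinal 6 1 isT
  | t3 => @Ordinal 6 2 isT | t4 => @Ordinal 6 3 isT
  | t5 => @Ordinal 6 4 isT | t6 => @Ordinal 6 5 isT
  end.

Definition ord_trans (i : 'I_6) : trans :=
  nth t1 [:: t1; t2; t3; t4; t5; t6] i.

Lemma trans_ordK : cancel trans_ord ord_trans. Proof. by case. Qed.

HB.instance Definition _ := Finite.copy trans (can_type trans_ordK).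

Definition zc_pre (p : place) (t : trans) : nat :=
  match t, p with
  | t1, p1 => 1
  | t2, (p4 | p5) => 1
  | t3, (p4 | p5 | p8) => 1
  | t4, p6 => 2
  | t5, (p5 | p6) => 1
  | t6, (p5 | p7) => 1
  | _, _ => 0
  end.

Definition zc_post (t : trans) (p : place) : nat :=
  match t, p with
  | t1, p5 => 2
  | t2, p6 => 1
  | t3, (p7 | p8) => 1
  | t4, p2 => 1
  | t4, p4 => 2
  | t5, (p3 | p4) => 1
  | t6, (p3 | p4) => 1
  | _, _ => 0
  end.

(* The marking {q, x.p4, p8}, for q other than p4 and p8. *)
Definition zc_marking (q : place) (x : nat) : {ffun place -> nat} :=
  [ffun p => if p == q then 1
             else match p with p4 => x | p8 => 1 | _ => 0 end].

Definition zero_check (x : nat) : ptnet place trans :=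
  PTNet zc_pre zc_post (zc_marking p1 x).

(* Main.v *)
Require Import Defs.
From mathcomp Require Import all_boot all_order zify.

Set Implicit Arguments.
Unset Strict Implicit.
Unset Printing Implicit Defensive.

Import Order.Theory.

(** The token of [p1] becomes two tokens in [p5].  If [x > 1], then [t2] has
    multiplicity 2 while [t3] is held to 1 by the single token of [p8], so [t2]
    takes both tokens at once, and [t4] restores [p4] and marks [p2].  If
    [x = 1], then [t2] and [t3] tie with multiplicity 1; either one leaves one
    token in [p5] and one in [p6] or [p7], and then [t5] or [t6], respectively,
    restores [p4] and marks [p3]. *)

Section PathEnds.

Variables (S : Type) (e : rel S).
Implicit Types (x y z : S) (s : seq S).

Definition stuck x : Prop := forall y, ~~ e x y.

Inductive all_paths_end_at y : S -> Prop :=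
  | AllPathsEndAtStuck : stuck y -> all_paths_end_at y y
  | AllPathsEndAtStep x z : e x z ->
      (forall z', e x z' -> all_paths_end_at y z') -> all_paths_end_at y x.

Lemma all_paths_end_at_finite y (r : nat -> S) :
  all_paths_end_at y (r 0) -> exists n, ~~ e (r n) (r n.+1).
Proof.
move r0E: (r 0) => x end_x.
elim: end_x r r0E => [y_stuck|{}x z _ _ IH] r r0E.
  by exists 0; rewrite r0E y_stuck.
have [r01|r01N] := boolP (e (r 0) (r 1)); last by exists 0.
rewrite r0E in r01.
by have [n rnN] := IH _ r01 (fun n => r n.+1) erefl; exists n.+1.
Qed.

Lemma all_paths_end_at_last y x s :
  all_paths_end_at y x -> path e x s -> stuck (last x s) -> last x s = y.
Proof.
move=> end_x; elim: end_x s => [y_stuck|{}x z xz _ IH] [|x' s] //=.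
- by rewrite (negbTE (y_stuck x')).
- by move=> _ /(_ z); rewrite xz.
- by move=> /andP[/IH]; apply.
Qed.

End PathEnds.

Lemma all_paths_end_at_succ (S : eqType) (e : rel S) x y z s :
  e x =i z :: s -> {in z :: s, forall z', all_paths_end_at e y z'} ->
  all_paths_end_at e y x.
Proof.
move=> succE end_s; apply: (@AllPathsEndAtStep _ _ _ _ z) => [|z' xz'].
  by have := mem_head z s; rewrite -succE.
by apply: end_s; rewrite -succE.
Qed.

Section StrongSleptsovNets.

Variables (P T : finType) (N : ptnet P T).
Implicit Types (mu nu : {ffun P -> nat}) (t : T).

Lemma leq_fire_mult mu t p k : 0 < pre N p t ->
  (k <= fire_mult N mu t) = [forall q, k * pre N q t <= mu q].
Proof.
rewrite /fire_mult; case: pickP => [p0 p0_in _|/(_ p)-> //].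
rewrite -minEnat -leEnat.
apply/bigmin_geP/forallP => [[_ le_k] q|le_k].
  have [->|q_in] := posnP (pre N q t); first by rewrite muln0.
  by rewrite leEnat -leq_divRL //; apply: le_k.
by split=> [|q q_in]; rewrite leEnat leq_divRL.
Qed.

(* The truncated subtraction is exact only for k <= fire_mult N mu t. *)
Definition fire_times k mu t : {ffun P -> nat} :=
  [ffun p => mu p - k * pre N p t + k * post N t p].

Lemma sstep_max mu k t (A : seq T) : 0 < k ->
  (forall u, fire_mult N mu u <= k ?= iff (u \in t :: A)) ->
  sstep N mu =i [seq fire_times k mu u | u <- t :: A].
Proof.
move=> k_gt0 multE nu.
have multA u : u \in t :: A -> fire_mult N mu u = k.
  by rewrite -(multE u) => /eqP.
apply/existsP/mapP => [[u /and3P[_ /forallP u_max /eqP->]]|[u uA ->]].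
  have uA : u \in t :: A.
    by rewrite -(geq_leqif (multE u)) -[leqLHS](multA t) ?mem_head.
  by exists u; rewrite // /fire multA.
exists u; rewrite /firable /fire multA // k_gt0 eqxx andbT.
by apply/forallP => v; apply: multE.
Qed.

Lemma terminalP mu : reflect (stuck (sstep N) mu) (terminal N mu).
Proof.
apply: (iffP forallP) => [term nu|mu_stuck t].
  by apply/existsP => -[t /and3P[]]; rewrite (negbTE (term t)).
apply/negP => t_fir.
have [u _ u_max] := arg_maxnP (fire_mult N mu) (erefl (xpredT t)).
have /existsP[] := mu_stuck (fire N mu u); exists u; rewrite eqxx andbT.
apply/andP; split; first exact: leq_trans (u_max t isT).
by apply/forallP => v; apply: u_max.
Qed.

Lemma maximal_runs_end_at nu : all_paths_end_at (sstep N) nu (init N) ->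
  every_run_terminates N /\ forall s, maximal_run N s -> final_marking N s = nu.
Proof.
move=> end_nu; split=> [|s []]; last exact: all_paths_end_at_last.
split=> [[r [r0 rS]]|s [_ /terminalP] //].
rewrite -r0 in end_nu.
by have [n] := all_paths_end_at_finite end_nu; rewrite rS.
Qed.

End StrongSleptsovNets.

Section ZeroCheck.

Variable x : nat.
Local Notation N := (zero_check x).

Lemma zero_check_fire_mult mu t : fire_mult N mu t =
  match t with
  | t1 => mu p1
  | t2 => minn (mu p4) (mu p5)
  | t3 => minn (mu p4) (minn (mu p5) (mu p8))
  | t4 => mu p6 %/ 2
  | t5 => minn (mu p5) (mu p6)
  | t6 => minn (mu p5) (mu p7)
  end.
Proof.
have [q q_in] : exists q, 0 < pre N q t.
  by case: t; [exists p1|exists p4|exists p4|exists p6|exists p5|exists p5].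
apply/eqP/eqn_geP => k; rewrite (leq_fire_mult _ _ q_in) {q q_in}.
apply/forallP/idP => [le_k|le_k p].
  move: (le_k p1) (le_k p4) (le_k p5) (le_k p6) (le_k p7) (le_k p8).
  by case: t {le_k} => /=; lia.
by case: t le_k; case: p => /=; lia.
Qed.

Definition mid_marking r a b c : {ffun place -> nat} :=
  [ffun p => match p with
             | p4 => r | p5 => a | p6 => b | p7 => c | p8 => 1 | _ => 0
             end].

Ltac marking_eq := apply/ffunP; case; rewrite !ffunE //=; lia.

Lemma fire_times_t1 r :
  fire_times N 1 (zc_marking p1 r) t1 = mid_marking r 2 0 0.
Proof. by marking_eq. Qed.

Lemma fire_times_t2 k r a b c :
  fire_times N k (mid_marking (k + r) (k + a) b c) t2 =
    mid_marking r a (k + b) c.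
Proof. by marking_eq. Qed.

Lemma fire_times_t3 r a b c :
  fire_times N 1 (mid_marking r.+1 a.+1 b c) t3 = mid_marking r a b c.+1.
Proof. by marking_eq. Qed.

Lemma fire_times_t4 r :
  fire_times N 1 (mid_marking r 0 2 0) t4 = zc_marking p2 r.+2.
Proof. by marking_eq. Qed.

Lemma fire_times_t5 r :
  fire_times N 1 (mid_marking r 1 1 0) t5 = zc_marking p3 r.+1.
Proof. by marking_eq. Qed.

Lemma fire_times_t6 r :
  fire_times N 1 (mid_marking r 1 0 1) t6 = zc_marking p3 r.+1.
Proof. by marking_eq. Qed.

Ltac compare_fire_mult t :=
  apply/leqifP; rewrite zero_check_fire_mult; case: t; rewrite !ffunE /=; lia.

Lemma sstep_t1 r : sstep N (zc_marking p1 r) =i [:: mid_marking r 2 0 0].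
Proof.
rewrite -fire_times_t1; apply: (sstep_max (A := [::])) => // t.
by compare_fire_mult t.
Qed.

Lemma sstep_t2 r : sstep N (mid_marking r.+2 2 0 0) =i [:: mid_marking r 0 2 0].
Proof.
rewrite -[mid_marking r 0 2 0](fire_times_t2 2).
apply: (sstep_max (A := [::])) => // t.
by compare_fire_mult t.
Qed.

Lemma sstep_t2_t3 :
  sstep N (mid_marking 1 2 0 0) =i
    [:: mid_marking 0 1 1 0; mid_marking 0 1 0 1].
Proof.
rewrite -[mid_marking 0 1 1 0](fire_times_t2 1) -fire_times_t3.
apply: (sstep_max (A := [:: t3])) => // t.
by compare_fire_mult t.
Qed.

Lemma sstep_t4 r : sstep N (mid_marking r 0 2 0) =i [:: zc_marking p2 r.+2].
Proof.
rewrite -fire_times_t4; apply: (sstep_max (A := [::])) => // t.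
by compare_fire_mult t.
Qed.

Lemma sstep_t5 : sstep N (mid_marking 0 1 1 0) =i [:: zc_marking p3 1].
Proof.
rewrite -fire_times_t5; apply: (sstep_max (A := [::])) => // t.
by compare_fire_mult t.
Qed.

Lemma sstep_t6 : sstep N (mid_marking 0 1 0 1) =i [:: zc_marking p3 1].
Proof.
rewrite -fire_times_t6; apply: (sstep_max (A := [::])) => // t.
by compare_fire_mult t.
Qed.

Lemma zc_marking_stuck q r :
  q \notin [:: p1; p5] -> stuck (sstep N) (zc_marking q r).
Proof.
move=> q_out; apply/terminalP/forallP => t.
rewrite /firable zero_check_fire_mult.
by case: q q_out => // _; case: t; rewrite !ffunE /=; lia.
Qed.

Lemma nonzero_ends_at_p2 r :
  all_paths_end_at (sstep N) (zc_marking p2 r.+2) (zc_marking p1 r.+2).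
Proof.
apply: (all_paths_end_at_succ (sstep_t1 _)) => _ /predU1P[->|//].
apply: (all_paths_end_at_succ (sstep_t2 _)) => _ /predU1P[->|//].
apply: (all_paths_end_at_succ (sstep_t4 _)) => _ /predU1P[->|//].
by constructor; apply: zc_marking_stuck.
Qed.

Lemma zero_ends_at_p3 :
  all_paths_end_at (sstep N) (zc_marking p3 1) (zc_marking p1 1).
Proof.
apply: (all_paths_end_at_succ (sstep_t1 _)) => _ /predU1P[->|//].
have end_p3 : all_paths_end_at (sstep N) (zc_marking p3 1) (zc_marking p3 1).
  by constructor; apply: zc_marking_stuck.
apply: (all_paths_end_at_succ sstep_t2_t3) => _ /[!inE] /orP[]/eqP->.
- by apply: (all_paths_end_at_succ sstep_t5) => _ /predU1P[->|//].
- by apply: (all_paths_end_at_succ sstep_t6) => _ /predU1P[->|//].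
Qed.

End ZeroCheck.

Lemma zero_check_runs x : 0 < x ->
  every_run_terminates (zero_check x) /\
  forall s, maximal_run (zero_check x) s ->
    final_marking (zero_check x) s = zc_marking (if x == 1 then p3 else p2) x.
Proof.
case: x => [//|[|r]] _; apply: maximal_runs_end_at.
  exact: zero_ends_at_p3.
exact: nonzero_ends_at_p2.
Qed.

Theorem theorem1 :
  (forall x : nat, 1 <= x ->
     every_run_terminates (zero_check x) /\
     forall s : seq {ffun place -> nat}, maximal_run (zero_check x) s ->
       (1 < x -> final_marking (zero_check x) s = zc_marking p2 x) /\
       (x = 1 -> final_marking (zero_check x) s = zc_marking p3 x)) /\
  (forall v : nat,
     every_run_terminates (zero_check v.+1) /\
     forall s : seq {ffun place -> nat}, maximal_run (zero_check v.+1) s ->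
       [/\ final_marking (zero_check v.+1) s p3 = (if v == 0 then 1 else 0),
           final_marking (zero_check v.+1) s p2 = (if 0 < v then 1 else 0)
         & final_marking (zero_check v.+1) s p4 = v.+1]).
Proof.
split=> [x /zero_check_runs[x_term x_final]|v].
  by split=> // s /x_final->; split=> [/gtn_eqF->|->].
have [v_term v_final] := zero_check_runs (ltn0Sn v).
split=> // s /v_final->.
by case: v {v_term v_final} => [|v]; rewrite !ffunE.
Qed.
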